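(* Let $\epsilon>0$ and $n,k$ positive integers. Suppose that for every symmetric matrix $B\in[0,4]^{k\times k}$ with entries averaging to $1$ there is a distribution $\mu_B$ over $n$-vertex graphs, and suppose there is an $\epsilon$-differentially node private algorithm such that for every such $B$, on input an $n$-vertex random graph $\mathbf G\sim\mu_B$, it outputs $\hat B(\mathbf G)\in\mathbb R^{k\times k}$ satisfying \[\Pr\left(\delta_2(\hat B(\mathbf G),B)\le\tfrac1{20}\right)\ge\tfrac23.\] Then $n\ge\Omega(k^2/\epsilon)$.
   Context: For $B\in\mathbb R^{k\times k}$ and $\phi:[0,1]\to[k]$ let $B^\phi(x,y)=B(\phi(x),\phi(y))$; $\phi$ is measure preserving if every preimage $\phi^{-1}(a)$ has Lebesgue measure $1/k$; $\delta_2(B_1,B_2)=\min_{\phi_1,\phi_2}\|B_1^{\phi_1}-B_2^{\phi_2}\|_{L_2([0,1]^2)}$ over measure-preserving $\phi_1,\phi_2$. An algorithm is $\epsilon$-differentially node private if $\Pr[\mathcal A(G)\in S]\le e^\epsilon\Pr[\mathcal A(G')\in S]$ for all events $S$ and all graphs $G,G'$ that can be made isomorphic by removing exactly one vertex from each.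
   Formalization: The bound is proved for every k at least 2, with one universal constant; k = 1 is excluded, since there the only matrix is (1), a constant algorithm is exact and private for every ε, and n = 1 with ε tending to 0 violates any bound n ≥ c/ε. *)

(* Defs.v *)
From HB Require Import structures.
From mathcomp Require Import all_boot all_order all_algebra all_fingroup.
From mathcomp Require Import all_classical all_reals all_analysis.

Set Implicit Arguments.
Unset Strict Implicit.
Unset Printing Implicit Defensive.

Import Order.TTheory GRing.Theory Num.Theory numFieldNormedType.Exports.

Local Open Scope classical_set_scope.
Local Open Scope ring_scope.

(* Adjacency matrices of the simple graphs on the vertex set 'I_n. *)
Definition sgraph (n : nat) : finType :=
  {A : 'M[bool]_n | (A^T == A) && [forall i, ~~ A i i]}.

(* row' u (col' u A) is the adjacency matrix of the graph with vertex u
   removed. *)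
Definition isomorphic (m : nat) (A B : 'M[bool]_m) : Prop :=
  exists s : 'S_m, forall i j, A (s i) (s j) = B i j.

Definition node_neighbors (n : nat) (G G' : sgraph n) : Prop :=
  exists u v : 'I_n,
    isomorphic (row' u (col' u (val G))) (row' v (col' v (val G'))).

Definition borel_mx (R : realType) (k : nat) :=
  g_sigma_algebraType (@open 'M[R]_k).

(* A randomized algorithm taking an n-vertex graph to a k x k real matrix is
   represented by its output distributions. *)
Definition algorithm (R : realType) (n k : nat) :=
  sgraph n -> probability (borel_mx R k) R.

(* Neighbouring graphs have the same number of vertices, so the condition can
   be imposed for each n separately. *)
Definition node_private (R : realType) (n k : nat) (eps : R)
    (A : algorithm R n k) : Prop :=
  forall G G' : sgraph n, node_neighbors G G' ->
  forall S : set (borel_mx R k), measurable S ->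
  (A G S <= (expR eps)%:E * A G' S)%E.

Definition is_distribution (R : realType) (T : finType) (mu : T -> R) : Prop :=
  (forall x, 0 <= mu x) /\ \sum_x mu x = 1.

(* Only the values of phi on [0, 1] matter. *)
Definition measure_preserving (R : realType) (k : nat) (phi : R -> 'I_k) : Prop :=
  forall a : 'I_k,
    measurable (`[0, 1] `&` phi @^-1` [set a] : set R) /\
    lebesgue_measure (`[0, 1] `&` phi @^-1` [set a]) = (k%:R^-1)%:E.

Definition blowup (R : realType) (k : nat) (B : 'M[R]_k) (phi : R -> 'I_k)
    (z : R * R) : R := B (phi z.1) (phi z.2).

Definition L2_unit_square (R : realType) (f : R * R -> R) : \bar R :=
  let g : R * R -> R := f \_ (`[0, 1] `*` `[0, 1]) in
  Lnorm (lebesgue_measure \x lebesgue_measure)%E 2%:E (EFin \o g).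

(* The infimum below is attained: the norm depends on (phi1, phi2) only through
   the numbers |phi1^-1(a) `&` phi2^-1(b)|, continuously, and these range over
   a compact set of k x k matrices. *)
Definition delta2 (R : realType) (k : nat) (B1 B2 : 'M[R]_k) : \bar R :=
  ereal_inf [set d | exists phi1 phi2 : R -> 'I_k,
    [/\ measure_preserving phi1, measure_preserving phi2 &
        d = L2_unit_square (fun z => blowup B1 phi1 z - blowup B2 phi2 z)]].

Definition admissible (R : realType) (k : nat) (B : 'M[R]_k) : Prop :=
  [/\ B^T = B,
      (forall i j, 0 <= B i j <= 4) &
      (\sum_i \sum_j B i j) / (k ^ 2)%N%:R = 1].

(* The probability, over G ~ mu and the internal randomness of A, that the
   output of A on input G lies in S. *)
Definition output_prob (R : realType) (n k : nat) (mu : sgraph n -> R)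
    (A : algorithm R n k) (S : set (borel_mx R k)) : \bar R :=
  (\sum_(G : sgraph n) (mu G)%:E * A G S)%E.

(* Main.v *)
Require Import Defs.
From mathcomp Require Import all_boot all_order all_algebra.
From mathcomp Require Import all_classical all_reals all_analysis.
From mathcomp Require Import perm measurable_realfun zify ring lra.
Import Order.TTheory GRing.Theory Num.Theory numFieldNormedType.Exports.
Local Open Scope classical_set_scope.
Local Open Scope ring_scope.

Set Implicit Arguments.
Unset Strict Implicit.
Unset Printing Implicit Defensive.

(* Any n-vertex graph can be turned into any other by rewiring one vertex at a
   time, so an eps-private algorithm satisfies
   A(G)(S) <= e^(eps n) A(G')(S) for all G, G'.  Hence N admissible matrices whose
   delta2-balls of radius 1/20 are disjoint force (2/3) N <= e^(eps n), and it
   remains to find exp(Omega(k^2)) of them.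

   delta2 depends on the relabellings only through a coupling w of the two label
   sets, with squared cost a form bilinear in (w, w).  Minimizing separately over
   the two copies of w replaces couplings by functions f, g : [k] -> [k] acting on
   rows and columns; there are only k^(2k) such pairs, while a symmetric matrix
   carries about k^2/4 free bits in an off-diagonal block, so a greedy choice of
   bit patterns at Hamming distance > k^2/32 from all relabellings of one another
   gives the packing.  For small k the two matrices with block pattern
   [[0, 2], [2, 0]] and with all entries 1 suffice. *)

(** * Packing of bit patterns *)

(** While the balls around the chosen points do not cover [T], a further point can be put in front.
    [e] may be asymmetric: a new point only has to avoid the balls of the older ones. *)
Lemma greedy_packing (T : finType) (e : rel T) (b : nat) :
  (forall y, #|[pred x | e x y]| <= b)%N ->
  forall m, (m * b < #|T|)%N ->
  exists s : seq T, size s = m.+1 /\ pairwise (fun x y => ~~ e x y) s.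
Proof.
move=> ball_le; elim=> [|m IHm] mb.
  have /card_gt0P[x _] : (0 < #|T|)%N by exact: mb.
  by exists [:: x].
have [|s [sz_s far_s]] := IHm; first by apply: leq_ltn_trans mb; rewrite leq_mul2r leqnSn orbT.
have cover_le : (#|[pred x | has (e x) s]| <= size s * b)%N.
  elim: s {IHm sz_s far_s} => [|y s IHs] /=; first by rewrite eq_card0.
  rewrite mulSn; apply: leq_trans (leq_add (ball_le y) IHs).
  rewrite -cardUI; apply: leq_trans (leq_addr _ _).
  by apply: subset_leq_card; apply/fintype.subsetP => x; rewrite !inE.
have /card_gt0P[x] : (0 < #|[predC [pred x | has (e x) s]]|)%N.
  rewrite -(ltn_add2l #|[pred x | has (e x) s]|) cardC addn0.
  by apply: leq_ltn_trans cover_le _; rewrite sz_s.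
rewrite !inE => /hasPn xs; exists (x :: s); rewrite /= sz_s far_s andbT; split=> //.
by apply/allP.
Qed.

Definition hamming (I : finType) (X Y : {ffun I -> bool}) : nat :=
  (\sum_p (X p != Y p))%N.

(* Markov's inequality for the weight 4^(#|I| - hamming X Y), whose total over
   X is 5^#|I|. *)
Lemma hamming_ball_card (I : finType) (r : nat) (Y : {ffun I -> bool}) :
  (#|[pred X | hamming X Y <= r]| * 4 ^ (#|I| - r) <= 5 ^ #|I|)%N.
Proof.
have <- : (\sum_(X : {ffun I -> bool}) 4 ^ (#|I| - hamming X Y) = 5 ^ #|I|)%N.
  rewrite (eq_bigr (fun X : {ffun I -> bool} => \prod_p 4 ^ (X p == Y p)))%N.
    rewrite -(bigA_distr_bigA (fun p b => 4 ^ (b == Y p)))%N.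
    rewrite (eq_bigr (fun=> 5))%N ?prod_nat_const// => p _.
    by rewrite big_bool; case: (Y p).
  move=> X _; rewrite -expn_sum; congr expn.
  apply: (@addIn (hamming X Y)); rewrite subnK.
    rewrite /hamming -big_split /= -sum1_card; apply: eq_bigr => p _.
    by case: eqP.
  rewrite /hamming -sum1_card; apply: leq_sum => p _; exact: leq_b1.
rewrite -sum_nat_const [leqRHS](bigID [pred X | (hamming X Y <= r)%N]) /=.
by apply: leq_trans (leq_addr _ _); apply: leq_sum => X /= XY; rewrite leq_pexp2l// leq_sub2l.
Qed.

(** Greedy choice, the ball of [Y] being the union over [j] of the Hamming balls around [P j Y]. The
    size bound is 2^|I| divided by a bound on the volume of this union, with denominators
    cleared. *)
Lemma bit_packing (I J : finType) (r : nat)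
    (P : J -> {ffun I -> bool} -> {ffun I -> bool}) : (0 < #|J|)%N ->
  exists s : seq {ffun I -> bool},
    (2 ^ #|I| * 4 ^ (#|I| - r) <= size s * (#|J| * 5 ^ #|I|))%N /\
    pairwise (fun X Y => [forall j, r < hamming X (P j Y)]%N) s.
Proof.
move=> J0; pose V := (5 ^ #|I| %/ 4 ^ (#|I| - r))%N.
have V0 : (0 < V)%N.
  rewrite divn_gt0 ?expn_gt0//; apply: (@leq_trans (4 ^ #|I|)); last first.
    by case: #|I| => // m; rewrite leq_exp2r.
  by rewrite leq_pexp2l// leq_subr.
have ball_le Y : (#|[pred X | [exists j, hamming X (P j Y) <= r]]| <= #|J| * V)%N.
  apply: (@leq_trans (\sum_j #|[pred X | hamming X (P j Y) <= r]|)%N); last first.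
    rewrite -sum_nat_const; apply: leq_sum => j _.
    by rewrite leq_divRL ?expn_gt0//; exact: hamming_ball_card.
  under eq_bigr do rewrite -sum1_card big_mkcond.
  rewrite -sum1_card exchange_big big_mkcond leq_sum//= => X _.
  by rewrite !inE; case: existsP => // -[j Xj]; rewrite (bigD1 j)//= inE Xj.
have card2 : #|{ffun I -> bool}| = (2 ^ #|I|)%N by rewrite card_ffun card_bool.
have b0 : (0 < #|J| * V)%N by rewrite muln_gt0 J0.
(* The largest [m] that [greedy_packing] admits; [m.+1] times the ball bound then reaches 2^|I|. *)
pose m := ((2 ^ #|I|).-1 %/ (#|J| * V))%N.
have [|s [sz_s far_s]] := @greedy_packing _
    (fun X Y => [exists j, hamming X (P j Y) <= r]%N) _ ball_le m.
  by rewrite card2; apply: leq_ltn_trans (leq_divM _ _) _; rewrite prednK ?expn_gt0.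
exists s; split; last first.
  apply: sub_pairwise far_s => X Y /existsPn far; apply/forallP => j.
  by rewrite ltnNge far.
have : (2 ^ #|I| <= size s * (#|J| * V))%N.
  by rewrite sz_s -[leqLHS]prednK ?expn_gt0// ltn_ceil.
rewrite -(leq_pmul2r (m := 4 ^ (#|I| - r))) ?expn_gt0// => /leq_trans; apply.
by rewrite -!mulnA !leq_mul2l leq_divM !orbT.
Qed.

(** With M = h^2 the last hypothesis yields 2^(3M) <= N k^(2h) 5^M 4^(M/8). In its eighth power the
    factors after N^8 are at most 2^M, 2^(19M) and 2^(2M), which leaves 2^(2M) for N^8. *)
Lemma packing_size_le (h k N : nat) : (400 <= k)%N -> (k <= h.*2.+1)%N ->
  (2 ^ (h * h) * 4 ^ (h * h - h * h %/ 8) <= N * (k ^ h * k ^ h * 5 ^ (h * h)))%N ->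
  (2 ^ (h * h) <= N ^ 8)%N.
Proof.
move=> k400 kh le1.
(* Here [400 <= k] enters: 16 (6 + k/64) <= (k - 1)/2. *)
have k16 : (k ^ 16 <= 2 ^ h)%N.
  pose t := (k %/ 64)%N.
  have kt : (k <= 2 ^ (6 + t))%N.
    apply: (@leq_trans (64 * t.+1)); first by rewrite /t; lia.
    by rewrite expnD leq_mul2l (ltn_expl t).
  apply: (@leq_trans ((2 ^ (6 + t)) ^ 16)); first by rewrite leq_exp2r.
  by rewrite -expnM leq_pexp2l// /t; lia.
have five8 : (5 ^ 8 <= 2 ^ 19)%N.
  have five3 : (5 ^ 3 <= 2 ^ 7)%N by [].
  have five2 : (5 ^ 2 <= 2 ^ 5)%N by [].
  rewrite (_ : 8 = 3 + 3 + 2)%N; last by [].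
  rewrite (_ : 19 = 7 + 7 + 5)%N; last by [].
  by rewrite !expnD; exact: leq_mul (leq_mul five3 five3) five2.
set M := (h * h)%N in le1 *.
have {}le1 : (2 ^ (3 * M) <= N * (k ^ h * k ^ h * 5 ^ M) * 4 ^ (M %/ 8))%N.
  have := leq_mul le1 (leqnn (4 ^ (M %/ 8))%N).
  rewrite -[X in (X <= _)%N]mulnA -expnD subnK; last exact: leq_div.
  by rewrite -expnMn [X in (_ -> X <= _)%N]expnM.
have pow_le a b e : (a <= b -> a ^ e <= b ^ e)%N.
  by case: e => // e ab; rewrite leq_exp2r.
suff : (2 ^ (M * 24) <= N ^ 8 * 2 ^ (M * 22))%N.
  rewrite (_ : M * 24 = M * 2 + M * 22)%N; last by lia.
  rewrite expnD leq_pmul2r ?expn_gt0; last by [].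
  by apply: leq_trans; rewrite leq_pexp2l ?leq_pmulr.
rewrite (_ : M * 24 = 3 * M * 8)%N; last by lia.
rewrite expnM; apply: leq_trans (pow_le _ _ 8 le1) _.
have kM : ((k ^ h) ^ 8 * (k ^ h) ^ 8 <= 2 ^ M)%N.
  rewrite -expnD -expnM mulnC expnM [leqRHS]expnM.
  exact: pow_le.
have fM : ((5 ^ M) ^ 8 <= 2 ^ (19 * M))%N.
  rewrite -expnM mulnC expnM [leqRHS]expnM.
  exact: pow_le.
have rM : ((4 ^ (M %/ 8)) ^ 8 <= 2 ^ (2 * M))%N.
  rewrite -expnM (expnM 2 2) leq_pexp2l; [by lia|by []|].
  by rewrite mulnC; lia.
rewrite (_ : M * 22 = M + 19 * M + 2 * M)%N; last by lia.
rewrite (expnD 2 (M + 19 * M)) (expnD 2 M) !expnMn -(mulnA (N ^ 8)%N) leq_mul2l.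
by apply/orP; right; exact: leq_mul (leq_mul kM fM) rM.
Qed.

(** * Couplings *)

(** With [w a b] the measure of the points labelled [a] by one map and [b] by the other, this is the
    squared L2 distance of the two blow-ups. *)
Definition coupling_cost (R : realType) (k : nat) (w : 'I_k -> 'I_k -> R)
    (B1 B2 : 'M[R]_k) : R :=
  \sum_a \sum_b \sum_c \sum_d w a b * w c d * (B1 a c - B2 b d) ^+ 2.

Definition coupling (R : realType) (k : nat) (w : 'I_k -> 'I_k -> R) : Prop :=
  [/\ forall a b, 0 <= w a b,
      forall a, \sum_b w a b = k%:R^-1 &
      forall b, \sum_a w a b = k%:R^-1].

(** Each row of [w] has mass 1/k, and moving all of it to a cheapest column does not raise the
    cost. *)
Lemma row_stochastic_argmin (R : realType) (k : nat) (w C : 'I_k -> 'I_k -> R) :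
  coupling w -> exists f : 'I_k -> 'I_k,
  k%:R^-1 * \sum_b C b (f b) <= \sum_b \sum_d w b d * C b d.
Proof.
move=> [w0 wr _].
exists (fun b => [arg min_(d < b) C b d]%O); rewrite mulr_sumr; apply: ler_sum => b _.
rewrite -(wr b) mulr_suml; apply: ler_sum => d _; apply: ler_wpM2l => //.
by case: arg_minP => // e _; apply.
Qed.

(* The cost is bilinear in the pair (w, w); minimizing over the two copies
   separately, the minimum over row-stochastic matrices is attained at
   functions. *)
Lemma coupling_cost_ge (R : realType) (k : nat) (w : 'I_k -> 'I_k -> R)
    (B1 B2 : 'M[R]_k) : coupling w ->
  exists f g : 'I_k -> 'I_k,
  (k%:R ^+ 2)^-1 * (\sum_a \sum_c (B1 a c - B2 (f a) (g c)) ^+ 2)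
    <= coupling_cost w B1 B2.
Proof.
move=> cw.
have [f Hf] := row_stochastic_argmin
  (fun a b => \sum_c \sum_d w c d * (B1 a c - B2 b d) ^+ 2) cw.
(* With [f] fixed, what remains is linear in the second copy of [w]. *)
have [g Hg] := row_stochastic_argmin
  (fun c d => \sum_a (B1 a c - B2 (f a) d) ^+ 2) cw.
exists f, g; rewrite /coupling_cost.
have -> : \sum_a \sum_b \sum_c \sum_d w a b * w c d * (B1 a c - B2 b d) ^+ 2 =
    \sum_a \sum_b w a b * \sum_c \sum_d w c d * (B1 a c - B2 b d) ^+ 2.
  apply: eq_bigr => a _; apply: eq_bigr => b _; rewrite mulr_sumr.
  apply: eq_bigr => c _; rewrite mulr_sumr; apply: eq_bigr => d _.
  by rewrite mulrA.
apply: le_trans Hf.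
rewrite expr2 invfM -mulrA ler_wpM2l ?invr_ge0//.
rewrite [leRHS](_ : _ = \sum_c \sum_d w c d * \sum_a (B1 a c - B2 (f a) d) ^+ 2).
  by rewrite exchange_big.
rewrite exchange_big; apply: eq_bigr => c _ /=.
rewrite exchange_big; apply: eq_bigr => d _ /=.
by rewrite mulr_sumr.
Qed.

Lemma ler_sum_inj (R : realType) (I J : finType) (u : I -> J) (F : J -> R) :
  injective u -> (forall j, 0 <= F j) -> \sum_i F (u i) <= \sum_j F j.
Proof.
move=> u_inj F0; pose A := finset.imset u (mem predT).
have <- : \sum_(j in A) F j = \sum_i F (u i).
  by rewrite big_imset//= => i j _ _; exact: u_inj.
by rewrite [leRHS](bigID (mem A)) /= lerDl sumr_ge0.
Qed.

(** Gluing of two couplings along their first marginal: [b] and [b'] are drawn independently given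
    [a], and the factor k is the inverse of the mass 1/k of [a]. *)
Definition glue (R : realType) (k : nat) (w1 w2 : 'I_k -> 'I_k -> R)
    (b b' : 'I_k) : R := k%:R * \sum_a w1 a b * w2 a b'.

Lemma coupling_glue (R : realType) (k : nat) (w1 w2 : 'I_k -> 'I_k -> R) :
  (0 < k)%N -> coupling w1 -> coupling w2 -> coupling (glue w1 w2).
Proof.
move=> k0 [w10 w1r w1c] [w20 w2r w2c].
have kk : k%:R * k%:R^-1 = 1 :> R by rewrite mulfV// pnatr_eq0 -lt0n.
split=> [b b'|b|b']; rewrite /glue.
- by rewrite mulr_ge0// sumr_ge0// => a _; rewrite mulr_ge0.
- rewrite -mulr_sumr exchange_big /=.
  under eq_bigr do rewrite -mulr_sumr w2r.
  by rewrite -mulr_suml w1c mulrA kk mul1r.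
- rewrite -mulr_sumr exchange_big /=.
  under eq_bigr do rewrite -mulr_suml w1r.
  by rewrite -mulr_sumr w2c mulrA kk mul1r.
Qed.

(** A squared triangle inequality through [M]: all three costs are averages over two independent
    triples (a, b, b') with the joint law [m], and the inequality holds pointwise. *)
Lemma coupling_cost_glue (R : realType) (k : nat) (w1 w2 : 'I_k -> 'I_k -> R)
    (M B1 B2 : 'M[R]_k) : (0 < k)%N -> coupling w1 -> coupling w2 ->
  coupling_cost (glue w1 w2) B1 B2 <=
  2 * (coupling_cost w1 M B1 + coupling_cost w2 M B2).
Proof.
move=> k0 [w10 w1r _] [w20 w2r _].
have kk : k%:R * k%:R^-1 = 1 :> R by rewrite mulfV// pnatr_eq0 -lt0n.
have kx x : k%:R * x / k%:R = x :> R by rewrite mulrAC kk mul1r.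
pose T := ('I_k * 'I_k * 'I_k)%type.
pose m (x : T) : R := k%:R * (w1 x.1.1 x.1.2 * w2 x.1.1 x.2).
have sumT (F : T -> R) : \sum_x F x = \sum_a \sum_b \sum_b' F (a, b, b').
  by rewrite !pair_bigA; apply: eq_bigr => -[[a b] c].
have m0 x : 0 <= m x by rewrite !mulr_ge0.
have E12 : coupling_cost (glue w1 w2) B1 B2 =
    \sum_x \sum_y m x * m y * (B1 x.1.2 y.1.2 - B2 x.2 y.2) ^+ 2.
  rewrite sumT [RHS]exchange_big; apply: eq_bigr => b _ /=.
  rewrite [RHS]exchange_big; apply: eq_bigr => b' _ /=.
  under [RHS]eq_bigr do rewrite sumT exchange_big /=.
  rewrite [RHS]exchange_big; apply: eq_bigr => d _ /=.
  under [RHS]eq_bigr do rewrite exchange_big /=.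
  rewrite [RHS]exchange_big; apply: eq_bigr => d' _ /=.
  rewrite -mulrA /glue mulr_sumr mulr_suml; apply: eq_bigr => a _.
  rewrite mulr_sumr mulr_suml mulr_sumr; apply: eq_bigr => c _.
  by rewrite /m /= !mulrA.
have E1 : coupling_cost w1 M B1 =
    \sum_x \sum_y m x * m y * (M x.1.1 y.1.1 - B1 x.1.2 y.1.2) ^+ 2.
  rewrite sumT; apply: eq_bigr => a _; apply: eq_bigr => b _ /=.
  under [RHS]eq_bigr do rewrite sumT.
  rewrite [RHS]exchange_big; apply: eq_bigr => c _ /=.
  rewrite [RHS]exchange_big; apply: eq_bigr => d _ /=.
  rewrite /m /=.
  transitivity (\sum_b' \sum_d' (k%:R * w1 a b * w2 a b' * (k%:R * w1 c d * w2 c d') *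
     (M a c - B1 b d) ^+ 2)); last first.
    by apply: eq_bigr => b' _; apply: eq_bigr => d' _; rewrite !mulrA.
  under eq_bigr do rewrite -mulr_suml -mulr_sumr -mulr_sumr w2r.
  rewrite -!mulr_suml -mulr_sumr w2r.
by rewrite !kx.
have E2 : coupling_cost w2 M B2 =
    \sum_x \sum_y m x * m y * (M x.1.1 y.1.1 - B2 x.2 y.2) ^+ 2.
  rewrite sumT; apply: eq_bigr => a _; rewrite [RHS]exchange_big; apply: eq_bigr => b _ /=.
  under [RHS]eq_bigr do rewrite sumT.
  rewrite [RHS]exchange_big; apply: eq_bigr => c _ /=.
  under [RHS]eq_bigr do rewrite exchange_big /=.
  rewrite [RHS]exchange_big; apply: eq_bigr => d _ /=.
  rewrite /m /=.
  transitivity (\sum_b' \sum_d' (k%:R * w2 a b * w1 a b' * (k%:R * w2 c d * w1 c d') *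
     (M a c - B2 b d) ^+ 2)).
    under eq_bigr do rewrite -mulr_suml -mulr_sumr -mulr_sumr w1r.
    rewrite -!mulr_suml -mulr_sumr w1r.
    by rewrite !kx.
  apply: eq_bigr => b' _; apply: eq_bigr => d' _; ring.
rewrite E12 E1 E2 -big_split /= mulr_sumr; apply: ler_sum => x _.
rewrite -big_split /= mulr_sumr; apply: ler_sum => y _.
rewrite -mulrDr [leRHS]mulrCA ler_wpM2l ?mulr_ge0//.
set p := M _ _; set q := B1 _ _; set r := B2 _ _.
(* This square equals 2 (p - q)^2 + 2 (p - r)^2 - (q - r)^2. *)
have := sqr_ge0 (2 * p - q - r); lra.
Qed.

(** * The distance delta2 in terms of couplings *)

(** Both preimages are cut to [0, 1] because [measure_preserving] gives measurability only there. *)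
Definition overlap_set (R : realType) (k : nat) (phi1 phi2 : R -> 'I_k)
    (a b : 'I_k) : set R :=
  (`[0, 1] `&` phi1 @^-1` [set a]) `&` (`[0, 1] `&` phi2 @^-1` [set b]).

Definition overlap (R : realType) (k : nat) (phi1 phi2 : R -> 'I_k)
    (a b : 'I_k) : R :=
  fine (lebesgue_measure (overlap_set phi1 phi2 a b)).

Lemma measurable_overlap_set (R : realType) (k : nat) (phi1 phi2 : R -> 'I_k) a b :
  measure_preserving phi1 -> measure_preserving phi2 ->
  measurable (overlap_set phi1 phi2 a b : set R).
Proof.
by move=> /(_ a)[m1 _] /(_ b)[m2 _]; exact: measurableI.
Qed.

Lemma overlapE (R : realType) (k : nat) (phi1 phi2 : R -> 'I_k) a b :
  measure_preserving phi1 -> measure_preserving phi2 ->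
  lebesgue_measure (overlap_set phi1 phi2 a b) = (overlap phi1 phi2 a b)%:E.
Proof.
move=> m1 m2; rewrite fineK// ge0_fin_numE//.
apply: (@le_lt_trans _ _ (lebesgue_measure (`[0, 1] : set R))); last first.
  by rewrite lebesgue_measure_itv /= lte_fin ltr01 -EFinB ltry.
by apply: le_measure; rewrite ?inE//; [exact: measurable_overlap_set|move=> x [[]]].
Qed.

Lemma coupling_overlap (R : realType) (k : nat) (phi1 phi2 : R -> 'I_k) :
  measure_preserving phi1 -> measure_preserving phi2 ->
  coupling (overlap phi1 phi2).
Proof.
move=> m1 m2; split=> [a b|a|b].
- by rewrite fine_ge0.
- apply: EFin_inj; have [mA <-] := m1 a; rewrite -sumEFin.
  under eq_bigr do rewrite -overlapE//.
  rewrite -measure_bigsetU_ord => [|b|].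
  + congr lebesgue_measure; apply/seteqP; split=> x.
      by rewrite -bigcup_seq => -[b _] [].
    move=> xa; rewrite -bigcup_seq.
      by exists (phi2 x); [exact: mem_index_enum|split=> //; case: xa].
  + exact: measurable_overlap_set.
  + by move=> b b' _ _ [x [[_ [_ <-]] [_ [_ <-]]]].
- apply: EFin_inj; have [mA <-] := m2 b; rewrite -sumEFin.
  under eq_bigr do rewrite -overlapE//.
  rewrite -measure_bigsetU_ord => [|a|].
  + congr lebesgue_measure; apply/seteqP; split=> x.
      by rewrite -bigcup_seq => -[a _] [].
    move=> xa; rewrite -bigcup_seq.
      by exists (phi1 x); [exact: mem_index_enum|split=> //; case: xa].
  + exact: measurable_overlap_set.
  + by move=> a a' _ _ [x [[[_ <-] _] [[_ <-] _]]].
Qed.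

(** The products of overlap sets tile the unit square, and the difference of the blow-ups is
    constant on each of them. *)
Lemma L2_unit_square_blowup (R : realType) (k : nat) (phi1 phi2 : R -> 'I_k)
    (B1 B2 : 'M[R]_k) : measure_preserving phi1 -> measure_preserving phi2 ->
  L2_unit_square (fun z => blowup B1 phi1 z - blowup B2 phi2 z) =
  (Num.sqrt (coupling_cost (overlap phi1 phi2) B1 B2))%:E.
Proof.
move=> m1 m2; pose E := overlap_set phi1 phi2.
pose I := ('I_k * 'I_k * ('I_k * 'I_k))%type.
pose C (q : I) := (B1 q.1.1 q.2.1 - B2 q.1.2 q.2.2) ^+ 2.
pose F (q : I) : set (R * R) := E q.1.1 q.1.2 `*` E q.2.1 q.2.2.
have mE a b : measurable (E a b) by exact: measurable_overlap_set.
have mF q : measurable (F q) by exact: measurableX.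
rewrite /L2_unit_square unlock.
have -> : (\int[lebesgue_measure \x lebesgue_measure]_z
    `|(EFin \o ((fun z => blowup B1 phi1 z - blowup B2 phi2 z)
        \_ (`[0%R, 1%R] `*` `[0%R, 1%R]))%R) z| `^ 2 =
    \int[lebesgue_measure \x lebesgue_measure]_z
      (\sum_(q : I) (C q)%:E * (\1_(F q) z)%:E))%E.
  apply: eq_integral => z _; rewrite [LHS]/= powR_mulrn// real_normK ?num_real// /patch.
  under eq_bigr do rewrite -EFinM.
  rewrite sumEFin; congr EFin.
  case: ifPn => [|zF].
    rewrite inE => -[z1 z2].
    rewrite (bigD1 ((phi1 z.1, phi2 z.1), (phi1 z.2, phi2 z.2)))//= big1 => [|q qz].
      by rewrite indicE mem_set ?mulr1 ?addr0//; do !split.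
    rewrite indicE memNset ?mulr0// => -[[[_ e1] [_ e2]] [[_ e3] [_ e4]]].
    by move/eqP: qz; apply; case: q e1 e2 e3 e4 => [[a b] [c d]] /= <- <- <- <-.
  rewrite big1 ?expr0n// => q _.
  rewrite indicE memNset ?mulr0// => -[[[z1 _] _] [[z2 _] _]].
  by move/negP: zF; apply; rewrite inE.
rewrite ge0_integral_sum//; last 2 first.
- by move=> q; apply: measurable_funeM; apply/measurable_EFinP; apply: measurable_indic; exact: mF.
- by move=> q z _; rewrite mule_ge0 ?lee_fin ?sqr_ge0.
have -> : (\sum_(q : I) \int[lebesgue_measure \x lebesgue_measure]_z
    ((C q)%:E * (\1_(F q) z)%:E) =
    (coupling_cost (overlap phi1 phi2) B1 B2)%:E)%E.
  transitivity (\sum_(q : I) (C q * (overlap phi1 phi2 q.1.1 q.1.2 *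
      overlap phi1 phi2 q.2.1 q.2.2))%:E)%E.
    apply: eq_bigr => q _; rewrite ge0_integralZl_EFin ?sqr_ge0//; last first.
      by apply/measurable_EFinP; apply: measurable_indic; exact: mF.
    rewrite [RHS]EFinM; congr (_ * _)%E.
    rewrite integral_indic; [|exact: measurableT|exact: mF].
    by rewrite setIT EFinM -!overlapE//; apply: product_measure1E; exact: mE.
  rewrite sumEFin; congr EFin.
  rewrite /coupling_cost pair_bigA /= -(pair_bigA _ (fun p p' =>
    C (p, p') * (overlap phi1 phi2 p.1 p.2 * overlap phi1 phi2 p'.1 p'.2))) /=.
  apply: eq_bigr => p _; rewrite pair_bigA; apply: eq_bigr => p' _.
  by rewrite mulrC.
rewrite poweR_EFin powR12_sqrt//; have [w0 _ _] := coupling_overlap m1 m2.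
do 4! (apply: sumr_ge0 => ? _).
by rewrite mulr_ge0 ?sqr_ge0// mulr_ge0.
Qed.

Definition realizable (R : realType) (k : nat) (w : 'I_k -> 'I_k -> R) : Prop :=
  exists phi1 phi2, [/\ measure_preserving phi1, measure_preserving phi2 &
    w = overlap phi1 phi2].

(** Thresholds strictly above [e] express the infimum without a minimizer, and for fixed [w] the
    strict inequality is an open condition on [M]. *)
Lemma delta2_le (R : realType) (k : nat) (M B : 'M[R]_k) (e : R) : 0 <= e ->
  (delta2 M B <= e%:E)%E <->
  (forall x, e < x -> exists w, realizable w /\ coupling_cost w M B < x ^+ 2).
Proof.
move=> e0; have sqrt_lt (x c : R) : e < x -> (Num.sqrt c < x) = (c < x ^+ 2).
  move=> ex; have x0 : 0 < x by exact: le_lt_trans ex.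
  by rewrite -[X in _ < X = _]ger0_norm ?ltW// -sqrtr_sqr ltr_sqrt ?exprn_gt0.
split=> [le_e x ex|H].
  have [|d [phi1 [phi2 [m1 m2 ->]]]] := @ereal_inf_lt _ _ x%:E (le_lt_trans le_e _).
    by rewrite lte_fin.
  rewrite L2_unit_square_blowup// lte_fin sqrt_lt// => lt_x.
  by exists (overlap phi1 phi2); split=> //; exists phi1, phi2.
apply/lee_addgt0Pr => d d0.
have [|w [[phi1 [phi2 [m1 m2 ->]]] lt_d]] := H (e + d); first by rewrite ltrDl.
apply: ereal_inf_le; exists (L2_unit_square (fun z => blowup M phi1 z - blowup B phi2 z)).
  by exists phi1, phi2.
by rewrite L2_unit_square_blowup// -EFinD lee_fin ltW// sqrt_lt// ltrDl.
Qed.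

Lemma continuous_coupling_cost (R : realType) (k : nat) (w : 'I_k -> 'I_k -> R)
    (B : 'M[R]_k) : continuous (fun M : 'M[R]_k => coupling_cost w M B).
Proof.
move=> M; rewrite /coupling_cost.
apply: cvg_big => [||a _]; [exact: add_continuous|exact: nbhs_filter|].
apply: cvg_big => [||b _]; [exact: add_continuous|exact: nbhs_filter|].
apply: cvg_big => [||c _]; [exact: add_continuous|exact: nbhs_filter|].
apply: cvg_big => [||d _]; [exact: add_continuous|exact: nbhs_filter|].
apply: (@cvgM _ _ (nbhs M) _ (fun=> w a b * w c d)); first exact: cvg_cst.
apply: (@cvg_comp _ _ _ (fun N : 'M[R]_k => N a c - B b d) 
  (fun x : R => x ^+ 2)); last exact: exprn_continuous.
by apply: (@cvgB _ _ _ (nbhs M) _ (fun N : 'M[R]_k => N a c));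
  [exact: coord_continuous|exact: cvg_cst].
Qed.

(* A G_delta set, by [delta2_le]. *)
Lemma measurable_delta2_le (R : realType) (k : nat) (B : 'M[R]_k) (e : R) : 0 <= e ->
  measurable ([set M | (delta2 M B <= e%:E)%E] : set (borel_mx R k)).
Proof.
move=> e0.
have -> : [set M | (delta2 M B <= e%:E)%E] = \bigcap_(n : nat) \bigcup_(w in @realizable R k)
    [set M : 'M[R]_k | coupling_cost w M B < (e + n.+1%:R^-1) ^+ 2].
  apply/seteqP; split=> M /=.
    move=> /(delta2_le _ _ e0) H n _.
    have [|w [rw lt_w]] := H (e + n.+1%:R^-1); first by rewrite ltrDl invr_gt0.
    by exists w.
  move=> H; apply/(delta2_le _ _ e0) => x ex.
  have [n nx] : exists n : nat, n.+1%:R^-1 < x - e.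
    exists (Num.truncn (x - e)^-1); rewrite invf_plt ?posrE ?subr_gt0//.
    exact: truncnS_gt.
  have [w rw lt_w] := H n I; exists w; split=> //.
  have n0 : 0 < n.+1%:R^-1 :> R by rewrite invr_gt0.
  have ge0 : 0 <= e + n.+1%:R^-1 by rewrite addr_ge0// ltW.
  have lex : e + n.+1%:R^-1 <= x by rewrite -lerBrDl ltW.
  by apply: lt_le_trans lt_w _; rewrite ler_sqr// nnegrE (le_trans ge0).
(* The union over [w] may be uncountable, so it is treated as a union of open sets. *)
apply: bigcapT_measurable => n; apply: sub_sigma_algebra.
apply: bigcup_open => w _.
rewrite -[X in open X]/((fun M : 'M[R]_k => coupling_cost w M B) @^-1`
   [set x | x < (e + n.+1%:R^-1) ^+ 2]).
by apply: open_comp; [move=> M _; exact: continuous_coupling_cost|exact: open_lt].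
Qed.

(** * Group privacy *)

Definition sgraph_axiom (n : nat) (A : 'M[bool]_n) : bool :=
  (A^T == A) && [forall i, ~~ A i i].

(** A hybrid: [A] after the vertices below [t] have been rewired as in [B]. *)
Definition splice_mx (n t : nat) (A B : 'M[bool]_n) : 'M[bool]_n :=
  \matrix_(i, j) if (i < t)%N || (j < t)%N then B i j else A i j.

Lemma splice_sgraph (n t : nat) (G G' : sgraph n) :
  sgraph_axiom (splice_mx t (val G) (val G')).
Proof.
case: G G' => [A /= /andP[/eqP tA /forallP dA]] [B /= /andP[/eqP tB /forallP dB]].
apply/andP; split.
  apply/eqP/matrixP => i j; rewrite !mxE orbC.
  by rewrite -{1}tA -{1}tB !mxE.
by apply/forallP => i; rewrite mxE; case: ifP.
Qed.

Definition splice (n t : nat) (G G' : sgraph n) : sgraph n :=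
  exist (@sgraph_axiom n) _ (splice_sgraph t G G').

Lemma splice0 (n : nat) (G G' : sgraph n) : splice 0 G G' = G.
Proof. by apply: val_inj; apply/matrixP => i j; rewrite mxE. Qed.

Lemma splice_full (n : nat) (G G' : sgraph n) : splice n G G' = G'.
Proof. by apply: val_inj; apply/matrixP => i j; rewrite mxE ltn_ord. Qed.

Lemma node_neighbors_splice (n t : nat) (G G' : sgraph n) :
  (t < n)%N -> node_neighbors (splice t G G') (splice t.+1 G G').
Proof.
move=> tn; pose u := Ordinal tn; exists u, u, (1%g : 'S_n.-1) => i j.
(* The removed vertex has index [t], the only one on which the two thresholds differ. *)
have ltS (l : 'I_n.-1) : (lift u l < t.+1)%N = (lift u l < t)%N.
  by rewrite ltnS leq_eqVlt -[t]/(val u) (inj_eq val_inj) eq_sym (negbTE (neq_lift _ _)).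
rewrite 2!perm1 [LHS]mxE [RHS]mxE [LHS]mxE [RHS]mxE [LHS]mxE [RHS]mxE.
by rewrite !ltS.
Qed.

Lemma group_privacy (R : realType) (n k : nat) (eps : R) (A : algorithm R n k)
    (G G' : sgraph n) (S : set (borel_mx R k)) :
  node_private eps A -> measurable S ->
  (A G S <= (expR (eps * n%:R))%:E * A G' S)%E.
Proof.
move=> priv mS; rewrite -[in leRHS](splice_full G G').
suff H t : (t <= n)%N -> (A G S <= (expR (eps * t%:R))%:E * A (splice t G G') S)%E by exact: H.
elim: t => [_|t IHt tn]; first by rewrite mulr0 expR0 mul1e splice0.
apply: le_trans (IHt (ltnW tn)) _.
rewrite -natr1 mulrDr mulr1 expRD EFinM -muleA.
rewrite lee_pmul2l// ?lte_fin ?expR_gt0//.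
by apply: priv => //; exact: node_neighbors_splice.
Qed.

(** * Packing lower bound for private algorithms *)

(** [f] and [g] are arbitrary and unrelated, like the minimizers in [coupling_cost_ge]. *)
Definition well_separated (R : realType) (k : nat) (B1 B2 : 'M[R]_k) : Prop :=
  forall f g : 'I_k -> 'I_k,
  80^-1 * k%:R ^+ 2 <= \sum_a \sum_c (B1 a c - B2 (f a) (g c)) ^+ 2.

(* 80^-1 exceeds (20^-1 + 20^-1) ^+ 2, the squared diameter of a delta2-ball
   of radius 20^-1. *)
Lemma well_separated_delta2 (R : realType) (k : nat) (M B1 B2 : 'M[R]_k) :
  (0 < k)%N -> well_separated B1 B2 ->
  (delta2 M B1 <= (20^-1)%:E)%E -> ~ (delta2 M B2 <= (20^-1)%:E)%E.
Proof.
move=> k0 sep.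
have r0 : 0 <= 20^-1 :> R by rewrite invr_ge0.
(* [delta2_le] asks for a threshold strictly above 1/20; 1/19 works because 4/19^2 < 1/80. *)
have r_lt : 20^-1 < 19^-1 :> R by rewrite ltf_pV2 ?posrE// ltr_nat.
move=> /(delta2_le _ _ r0)/(_ _ r_lt)[w1 [[p1 [q1 [mp1 mq1 ->]]] lt1]].
move=> /(delta2_le _ _ r0)/(_ _ r_lt)[w2 [[p2 [q2 [mp2 mq2 ->]]] lt2]].
have c1 := coupling_overlap mp1 mq1; have c2 := coupling_overlap mp2 mq2.
have [f [g ge_fg]] := coupling_cost_ge B1 B2 (coupling_glue k0 c1 c2).
have le_g := coupling_cost_glue M B1 B2 k0 c1 c2.
have : 80^-1 <= (k%:R ^+ 2)^-1 * (\sum_a \sum_c (B1 a c - B2 (f a) (g c)) ^+ 2).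
  by rewrite mulrC ler_pdivlMr ?exprn_gt0 ?ltr0n.
lra.
Qed.

(** The events [S i] are disjoint, so on one reference graph, the empty one, their probabilities add
    up to at most 1, while group privacy makes each at least (2/3) e^(-eps n). *)
Lemma private_packing (R : realType) (n k N : nat) (eps : R)
    (mu : 'M[R]_k -> sgraph n -> R) (A : algorithm R n k) (B : 'I_N -> 'M[R]_k) :
  (0 < k)%N -> node_private eps A ->
  (forall i, is_distribution (mu (B i))) ->
  (forall i, ((2 / 3)%:E <=
     output_prob (mu (B i)) A [set M | delta2 M (B i) <= (20^-1)%:E])%E) ->
  (forall i j : 'I_N, (i < j)%N -> well_separated (B i) (B j)) ->
  N%:R * (2 / 3) <= expR (eps * n%:R).
Proof.
move=> k0 priv dist acc sep.
pose S i : set (borel_mx R k) := [set M | (delta2 M (B i) <= (20^-1)%:E)%E].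
have mS i : measurable (S i) by apply: measurable_delta2_le; rewrite invr_ge0.
have tS : trivIset setT S.
  move=> i j _ _ [M [Si Sj]]; have [lt_ij|lt_ji|/val_inj//] := ltngtP i j.
  - by case: (well_separated_delta2 k0 (sep i j lt_ij) Si Sj).
  - by case: (well_separated_delta2 k0 (sep j i lt_ji) Sj Si).
have e0 : 0 < expR (eps * n%:R) by exact: expR_gt0.
have G0P : sgraph_axiom (const_mx false : 'M[bool]_n).
  by rewrite /sgraph_axiom trmx_const eqxx; apply/forallP => i; rewrite mxE.
pose G0 : sgraph n := exist (@sgraph_axiom n) _ G0P.
pose p i := fine (A G0 (S i)).
have pE i : A G0 (S i) = (p i)%:E by rewrite fineK// fin_num_measure.
have p_ge i : 2 / 3 <= expR (eps * n%:R) * p i.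
  rewrite -lee_fin; apply: le_trans (acc i) _; rewrite /output_prob.
  have [mu0 mu1] := dist i.
  apply: (@le_trans _ _ (\sum_(G : sgraph n) (mu (B i) G)%:E * (expR (eps * n%:R) * p i)%:E)%E).
    apply: lee_sum => G _; apply: lee_wpmul2l; first by rewrite lee_fin.
    by rewrite EFinM -pE; exact: (group_privacy G G0 priv (mS i)).
  under eq_bigr do rewrite -EFinM.
  by rewrite sumEFin -mulr_suml mu1 mul1r.
have p_sum : \sum_i p i <= 1.
  rewrite -lee_fin -sumEFin; under eq_bigr do rewrite -pE.
  rewrite -measure_bigsetU_ord//; apply: probability_le1.
  by apply: bigsetU_measurable => i _.
apply: (@le_trans _ _ (\sum_(i < N) expR (eps * n%:R) * p i)).
  by rewrite -[N in N%:R]card_ord mulr_natl -sumr_const; apply: ler_sum => i _.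
by rewrite -mulr_sumr ler_piMr// ltW.
Qed.

(** * Admissible matrices carrying bits *)

Lemma sum_block_mx (R : nmodType) (m1 m2 n1 n2 : nat) (A : 'M[R]_(m1, n1))
    (B : 'M[R]_(m1, n2)) (C : 'M[R]_(m2, n1)) (D : 'M[R]_(m2, n2)) :
  \sum_i \sum_j block_mx A B C D i j =
  \sum_i \sum_j A i j + \sum_i \sum_j B i j +
  (\sum_i \sum_j C i j + \sum_i \sum_j D i j).
Proof.
rewrite big_split_ord /= -!big_split /=.
congr (_ + _); apply: eq_bigr => i _; rewrite big_split_ord /=.
  by congr (_ + _); apply: eq_bigr => j _; rewrite ?block_mxEul ?block_mxEur.
by congr (_ + _); apply: eq_bigr => j _; rewrite ?block_mxEdl ?block_mxEdr.
Qed.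

Lemma sum_const_mx (R : pzRingType) (m n : nat) (c : R) :
  \sum_i \sum_j (const_mx c : 'M[R]_(m, n)) i j = (m%:R * n%:R) * c.
Proof.
under eq_bigr do under eq_bigr do rewrite mxE.
by rewrite !sumr_const !card_ord -mulrnA -[in RHS]natrM mulr_natl mulnC.
Qed.

(** The bits fill [Y] with entries 0 and 2. The constant block [t], with entries in [0, 2], brings
    the average back to 1; the last [e] rows and columns accommodate odd k. *)
Definition code_mx (R : realType) (h e : nat) (X : {ffun 'I_h * 'I_h -> bool}) :
    'M[R]_(h + h + e) :=
  let Y : 'M[R]_h := \matrix_(i, j) ((X (i, j))%:R *+ 2) in
  let t : 'M[R]_h := const_mx (2 * (1 - (\sum_p (X p)%:R : R) / (h ^ 2)%N%:R)) in
  block_mx (block_mx t Y Y^T t) (const_mx 1) (const_mx 1) (const_mx 1).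

Lemma admissible_code_mx (R : realType) (h e : nat) (X : {ffun 'I_h * 'I_h -> bool}) :
  (0 < h)%N -> admissible (code_mx R e X).
Proof.
move=> h0; rewrite /code_mx; set Y := \matrix_(i, j) _; set s := \sum_p _.
have h2 : 0 < (h ^ 2)%N%:R :> R by rewrite ltr0n expn_gt0 h0.
have s0 : 0 <= s by apply: sumr_ge0.
have s1 : s <= (h ^ 2)%N%:R.
  apply: (@le_trans _ _ (\sum_(p : 'I_h * 'I_h) 1)).
    by apply: ler_sum => p _; case: (X p).
  by rewrite sumr_const card_prod card_ord expnS expn1.
have sd0 : 0 <= s / (h ^ 2)%N%:R by rewrite divr_ge0// ltW.
have sd1 : s / (h ^ 2)%N%:R <= 1 by rewrite ler_pdivrMr// mul1r.
have sY : \sum_i \sum_j Y i j = 2 * s.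
  rewrite pair_bigA mulr_sumr; apply: eq_bigr => -[i j] _ /=.
  by rewrite mxE mulr_natl.
have bit_le4 (b : bool) : 0 <= (b%:R *+ 2 : R) <= 4.
  have -> : b%:R = (if b then 1 else 0) :> R by case: b.
  by case: b; rewrite ?mul0rn ?mulr2n; apply/andP; split; lra.
set q := s / _ in sd0 sd1 *.
split.
- by rewrite !tr_block_mx !trmx_const trmxK.
- move=> i j; case: (split_ordP i) => {}i ->; case: (split_ordP j) => {}j ->;
    rewrite ?block_mxEul ?block_mxEur ?block_mxEdl ?block_mxEdr.
  + case: (split_ordP i) => {}i ->; case: (split_ordP j) => {}j ->;
    rewrite ?block_mxEul ?block_mxEur ?block_mxEdl ?block_mxEdr !mxE.
    * by apply/andP; split; lra.
    * exact: bit_le4.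
    * exact: bit_le4.
    * by apply/andP; split; lra.
  + by rewrite mxE; apply/andP; split; lra.
  + by rewrite mxE; apply/andP; split; lra.
  + by rewrite mxE; apply/andP; split; lra.
- have k0 : ((h + h + e) ^ 2)%N%:R != 0 :> R by rewrite pnatr_eq0; lia.
  apply/eqP; rewrite -(inj_eq (mulIf k0)) divfK// mul1r; apply/eqP.
  have qs : q * (h ^ 2)%N%:R = s by rewrite /q divfK// gt_eqF.
  rewrite !sum_block_mx !sum_const_mx sY.
  have -> : \sum_i \sum_j Y^T i j = 2 * s.
    by rewrite -sY exchange_big; apply: eq_bigr => i _; apply: eq_bigr => j _; rewrite mxE.

  rewrite -qs !natrX !natrD; ring.
Qed.

Lemma well_separated_of_block (R : realType) (h e : nat) (B1 B2 : 'M[R]_(h + h + e)) :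
  (0 < h)%N -> (e <= 1)%N ->
  (forall f g : 'I_h -> 'I_(h + h + e),
    8^-1 * (h ^ 2)%N%:R <=
    \sum_i \sum_j (B1 (lshift e (lshift h i)) (lshift e (rshift h j)) -
                   B2 (f i) (g j)) ^+ 2) ->
  well_separated B1 B2.
Proof.
move=> h0 e1 H f g.
pose u i := lshift e (lshift h i) : 'I_(h + h + e).
pose v j := lshift e (rshift h j) : 'I_(h + h + e).
apply: le_trans (le_trans _ (H (f \o u) (g \o v))) _.
  (* k <= 3h since e <= 1 <= h, and 9/80 < 1/8. *)
  have le9 : (h + h + e)%:R ^+ 2 <= 9 * (h ^ 2)%N%:R :> R.
    by rewrite -natrX -natrM ler_nat !expnS !expn0; nia.
  have h2 : 0 <= (h ^ 2)%N%:R :> R by [].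
  lra.
have uI : injective u by move=> i j /lshift_inj/lshift_inj.
have vI : injective v by move=> i j /lshift_inj/rshift_inj.
apply: (@le_trans _ _ (\sum_i \sum_c (B1 (u i) c - B2 (f (u i)) (g c)) ^+ 2)).
  apply: ler_sum => i _.
  apply: (ler_sum_inj (F := fun c => (B1 (u i) c - B2 (f (u i)) (g c)) ^+ 2) vI) => c.
  exact: sqr_ge0.
apply: (ler_sum_inj (F := fun a => \sum_c (B1 a c - B2 (f a) (g c)) ^+ 2) uI) => a.
by apply: sumr_ge0 => c _; exact: sqr_ge0.
Qed.

(** With all bits set, the block [Y] is constantly 2, so each of its h^2 entries is off by 1
    whatever [f] and [g] are. *)
Lemma well_separated_all_ones (R : realType) (h e : nat) : (0 < h)%N -> (e <= 1)%N ->
  well_separated (code_mx R e [ffun=> true]) (const_mx 1 : 'M[R]_(h + h + e)).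
Proof.
move=> h0 e1; apply: well_separated_of_block => // f g.
under eq_bigr => i _. under eq_bigr => j _.
  rewrite /code_mx block_mxEul block_mxEur !mxE ffunE mulr2n addrK expr1n. over. over.
rewrite !sumr_const !card_ord -mulr_natr expnS expn1 natrM.
have : 0 <= h%:R * h%:R :> R by rewrite mulr_ge0.
lra.
Qed.

Lemma admissible_const1 (R : realType) (k : nat) : (0 < k)%N ->
  admissible (const_mx 1 : 'M[R]_k).
Proof.
move=> k0; split; first by rewrite trmx_const.
- by move=> i j; rewrite mxE; apply/andP; split; lra.
- by rewrite sum_const_mx mulr1 -natrM expnS expn1 divff// pnatr_eq0 -lt0n muln_gt0 k0.
Qed.

(* The threshold 1 rounds an arbitrary real target to the nearest entry 0 or 2
   of a code matrix; each wrong bit then costs at least 1. *)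
Definition decode (R : realType) (h k : nat) (B : 'M[R]_k)
    (f g : 'I_h -> 'I_k) : {ffun 'I_h * 'I_h -> bool} :=
  [ffun p => 1 < B (f p.1) (g p.2)].

Lemma well_separated_code_mx (R : realType) (h e : nat)
    (X Y : {ffun 'I_h * 'I_h -> bool}) : (0 < h)%N -> (e <= 1)%N ->
  (forall f g : 'I_h -> 'I_(h + h + e),
    h * h %/ 8 < hamming X (decode (code_mx R e Y) f g))%N ->
  well_separated (code_mx R e X) (code_mx R e Y).
Proof.
move=> h0 e1 far; apply: well_separated_of_block => // f g.
apply: (@le_trans _ _ (hamming X (decode (code_mx R e Y) f g))%:R).
  (* An integer above the floor of h^2/8 is at least h^2/8. *)
  rewrite mulrC ler_pdivrMr// -natrM ler_nat expnS expn1.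
  by have := far f g; lia.
rewrite /hamming natr_sum pair_bigA; apply: ler_sum => -[i j] _ /=.
rewrite {1}/code_mx block_mxEul block_mxEur mxE /decode ffunE /=.
set y := code_mx R e Y _ _.
case: (ltP 1 y) => y1; case: (X (i, j)); rewrite ?sqr_ge0//= ?mul0rn ?mulr2n; nra.
Qed.

(* The constant hidden in Omega is c; it does not depend on eps, n, k, the
   family mu or the algorithm.  The bound is asserted for every k >= 2.  For
   k = 1 the only admissible matrix is (1), a constant algorithm satisfies the
   hypotheses for every eps > 0, and no bound of this form holds. *)
Theorem theoremF1 (R : realType) :
  exists c : R, 0 < c /\
  forall (eps : R) (n k : nat), 0 < eps -> (0 < n)%N -> (1 < k)%N ->
  forall mu : 'M[R]_k -> sgraph n -> R,
  (forall B : 'M[R]_k, admissible B -> is_distribution (mu B)) ->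
  forall A : algorithm R n k,
  node_private eps A ->
  (forall B : 'M[R]_k, admissible B ->
     ((2 / 3)%:E <=
        output_prob (mu B) A
          [set M | delta2 M B <= (20^-1)%:E])%E) ->
  c * (k ^ 2)%N%:R / eps <= n%:R.
Proof.
have ln2 : 0 < ln 2 :> R by rewrite ln_gt0// ltr1n.
(* 480 * 1000 = 3 * 400^2 comes from the case k < 400, where eps n >= ln 2 / 3; for larger k the
   argument gives even ln 2 / 216. *)
exists (ln 2 / (480 * 1000)); split; first by lra.
move=> eps n k eps0 n0 k1.
pose h := k./2; pose e : nat := odd k.
have kE : k = (h + h + e)%N by rewrite addnn addnC odd_double_half.
have h0 : (0 < h)%N by rewrite half_gt0.
have e1 : (e <= 1)%N by exact: leq_b1.
have k0 : (0 < h + h + e)%N by lia.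
clearbody h e; subst k => mu dist A priv acc.
set E := expR (eps * n%:R).
(* Two separated matrices give 2 * (2/3) <= E. For large k this also absorbs a constant: N <= (3/2)
   E <= E^3. *)
have E_ge : 4 / 3 <= E.
  pose B (i : 'I_2) : 'M[R]_(h + h + e) :=
    if i == 0%N :> nat then code_mx R e [ffun=> true] else const_mx 1.
  have admB i : admissible (B i).
    by rewrite /B; case: ifP => _; [exact: admissible_code_mx|exact: admissible_const1].
  have := private_packing (B := B) k0 priv (fun i => dist _ (admB i)) (fun i => acc _ (admB i)).
  rewrite mulrA -natrM; apply => -[[|[|//]] i2] [[|[|//]] j2] //= _.
  exact: well_separated_all_ones.
rewrite ler_pdivrMr//.
have E_cube : 2 <= E ^+ 3 by rewrite !exprS expr0 mulr1; nra.
have ln_expR_le (m p : nat) : 2 ^+ m <= E ^+ p -> m%:R * ln 2 <= p%:R * (eps * n%:R).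
  rewrite /E -expRM_natl => le_mp.
  have : ln (2 ^+ m) <= ln (expR (p%:R * (eps * n%:R))) :> R.
    by rewrite ler_ln ?posrE ?expR_gt0 ?exprn_gt0.
  by rewrite expRK lnXn// (mulr_natl (ln 2)).
have [k_lt|k_ge] := ltnP (h + h + e) 400.
  have := ln_expR_le 1%N 3%N; rewrite expr1 mul1r => /(_ E_cube) le3.
  have : (h + h + e)%:R <= 400 :> R by rewrite ler_nat ltnW.
  have : 0 <= (h + h + e)%:R :> R by [].
  rewrite natrX; move: (_%:R) => K K0 K400.
  have : K ^+ 2 <= 400 * 400 by rewrite expr2; apply: ler_pM.
  nra.
(* Only the images of the h rows and h columns of the bit block matter, which leaves k^(2h)
   pairs. *)
pose J := ({ffun 'I_h -> 'I_(h + h + e)} * {ffun 'I_h -> 'I_(h + h + e)})%type.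
have [|s [sz_s sep_s]] := @bit_packing ('I_h * 'I_h)%type J (h * h %/ 8)
    (fun fg Y => decode (code_mx R e Y) fg.1 fg.2).
  by rewrite card_prod !card_ffun !card_ord muln_gt0 !expn_gt0 k0.
rewrite !card_prod !card_ffun !card_ord in sz_s.
have le_sz : (2 ^ (h * h) <= size s ^ 8)%N.
  by apply: packing_size_le sz_s => //; lia.
pose B (i : 'I_(size s)) : 'M[R]_(h + h + e) := code_mx R e (tnth (in_tuple s) i).
have admB i : admissible (B i) by exact: admissible_code_mx.
have szE : (size s)%:R <= E ^+ 3.
  have : (size s)%:R * (2 / 3) <= E.
    apply: (private_packing (B := B) k0 priv (fun i => dist _ (admB i)) (fun i => acc _ (admB i))).
    move=> i j lt_ij; apply: well_separated_code_mx => // f g.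
    have := pairwiseP [ffun=> false] sep_s; move=> /(_ i j (ltn_ord i) (ltn_ord j) lt_ij).
    move=> /forallP/(_ ([ffun x => f x], [ffun x => g x])).
    rewrite !(tnth_nth [ffun=> false]) /=.
    by congr (_ < hamming _ _)%N; apply/ffunP => p; rewrite !ffunE.
  by rewrite !exprS expr0 mulr1; nra.
(* With N = [size s]: 2^(h^2) <= N^8 <= (E^3)^8. *)
have le_pow : 2 ^+ (h * h) <= E ^+ (3 * 8).
  rewrite [leRHS]exprM; apply: le_trans (lerXn2r 8 _ _ szE); rewrite ?nnegrE ?exprn_ge0 ?expR_ge0//.
  by rewrite -!natrX ler_nat.
have le24 := ln_expR_le _ _ le_pow.
have : ((h + h + e) ^ 2)%N%:R <= 9 * (h * h)%N%:R :> R.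
  by rewrite -natrM ler_nat !expnS !expn0; nia.
set K := _%:R; nra.
Qed.
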